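(* Let $\mathcal{M}=(X,\leq,V)$ and $\mathcal{M}'=(X',\leq',V')$ be intuitionistic Kripke models that are both image-compact and pre-image-compact for $\mathsf{Bi\text{-}int}$, and let $x\in X$, $x'\in X'$. Then $x$ and $x'$ are $\mathsf{Bi\text{-}int}$-bisimilar if and only if they satisfy exactly the same $\mathsf{Bi\text{-}int}$-formulae.
   Context: Fix a set $\mathrm{Prop}$ of propositional variables. $\mathsf{Bi\text{-}int}$ is the set of formulae $\phi ::= \top\mid\bot\mid p\mid \phi\wedge\phi\mid\phi\vee\phi\mid\phi\to\phi\mid\phi\,{-\!\!<}\,\phi$. An intuitionistic Kripke model is $(X,\leq,V)$ with $\leq$ a preorder on $X$ and $V$ assigning to each $p$ an upset of $(X,\leq)$. Truth: $\top,\bot,p,\wedge,\vee$ as usual ($x\Vdash p$ iff $x\in V(p)$); $x\Vdash\phi\to\psi$ iff for all $y\geq x$, $y\Vdash\phi$ implies $y\Vdash\psi$; $x\Vdash\phi\,{-\!\!<}\,\psi$ iff there is $y\leq x$ with $y\Vdash\phi$ and $y\not\Vdash\psi$. For upsets $a,b$ let $a\Rightarrow b=\{x\mid\forall y\geq x(y\in a\Rightarrow y\in b)\}$ and $a\ominus b=\{x\mid\exists y\leq x,\ y\in a,\ y\notin b\}$. A model is image-compact (resp. pre-image-compact) for $\mathsf{Bi\text{-}int}$ if there is a collection $A$ of upsets containing $\emptyset$, $X$ and all $V(p)$, closed under finite unions, finite intersections, $\Rightarrow$ and $\ominus$, such that for every $x$ the set ${\uparrow}x=\{y\mid x\leq y\}$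 (resp. ${\downarrow}x=\{y\mid y\leq x\}$) is compact in the topology $\tau_A$ generated by the subbase $A\cup\{X\setminus a\mid a\in A\}$ (the two properties may be witnessed by different $A$). A $\mathsf{Bi\text{-}int}$-bisimulation is a relation $B\subseteq X\times X'$ such that for all $(x,x')\in B$: (B1) $x\in V(p)$ iff $x'\in V'(p)$ for all $p$; (B2) if $x\leq y$ there is $y'$ with $x'\leq'y'$ and $yBy'$; (B3) if $x'\leq'y'$ there is $y$ with $x\leq y$ and $yBy'$; (B4) if $y\leq x$ there is $y'$ with $y'\leq'x'$ and $yBy'$; (B5) if $y'\leq'x'$ there is $y$ with $y\leq x$ and $yBy'$. States are $\mathsf{Bi\text{-}int}$-bisimilar if some such $B$ contains the pair. *)

(* Defs.v *)
From HB Require Import structures.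
From mathcomp Require Import all_boot.
From mathcomp Require Import boolp classical_sets topology.

Set Implicit Arguments.
Unset Strict Implicit.
Unset Printing Implicit Defensive.

Local Open Scope classical_set_scope.

Inductive formula (P : Type) : Type :=
| Top
| Bot
| Var of P
| And of formula P & formula P
| Or of formula P & formula P
| Imp of formula P & formula P
| Excl of formula P & formula P.

Definition is_upset (X : Type) (kle : X -> X -> Prop) (a : set X) : Prop :=
  forall x y, kle x y -> a x -> a y.

Record model (P : Type) := Model {
  world :> Type;
  kle : world -> world -> Prop;
  kval : P -> set world;
  kle_refl : forall x, kle x x;
  kle_trans : forall x y z, kle x y -> kle y z -> kle x z;
  kval_upset : forall p, is_upset kle (kval p)
}.

Fixpoint truth (P : Type) (M : model P) (phi : formula P) (x : M) : Prop :=
  match phi with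
  | Top => True
  | Bot => False
  | Var p => kval p x
  | And phi1 phi2 => truth phi1 x /\ truth phi2 x
  | Or phi1 phi2 => truth phi1 x \/ truth phi2 x
  | Imp phi1 phi2 => forall y : M, kle x y -> truth phi1 y -> truth phi2 y
  | Excl phi1 phi2 => exists y : M, [/\ kle y x, truth phi1 y & ~ truth phi2 y]
  end.

Definition up_imp (P : Type) (M : model P) (a b : set M) : set M :=
  [set x | forall y, kle x y -> a y -> b y].

Definition up_excl (P : Type) (M : model P) (a b : set M) : set M :=
  [set x | exists y, [/\ kle y x, a y & ~ b y]].

(* Closure under finite unions and intersections amounts to the nullary cases
   set0 and setT together with the binary ones. *)
Definition biint_collection (P : Type) (M : model P) (A : set (set M)) : Prop :=
  [/\ forall a, A a -> is_upset (@kle P M) a,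
      [/\ A set0, A setT & forall p, A (kval p)],
      forall a b, A a -> A b -> A (a `|` b),
      forall a b, A a -> A b -> A (a `&` b) &
      forall a b, A a -> A b -> A (up_imp a b) /\ A (up_excl a b)].

Definition subbase (X : Type) (A : set (set X)) : set (set X) :=
  A `|` [set ~` a | a in A].

(* A copy of X, so that its topology can depend on A. *)
Definition tau (X : Type) (A : set (set X)) : Type := X.

HB.instance Definition _ (X : Type) (A : set (set X)) :=
  gen_eqMixin (tau A).
HB.instance Definition _ (X : Type) (A : set (set X)) :=
  gen_choiceMixin (tau A).
HB.instance Definition _ (X : Type) (A : set (set X)) :=
  @isSubBaseTopological.Build (tau A) (set X) (subbase A) id.

Definition image_compact (P : Type) (M : model P) : Prop :=
  exists A : set (set M), biint_collection A /\
    forall x : M, compact ([set y | kle x y] : set (tau A)).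

Definition preimage_compact (P : Type) (M : model P) : Prop :=
  exists A : set (set M), biint_collection A /\
    forall x : M, compact ([set y | kle y x] : set (tau A)).

Definition bisimulation (P : Type) (M M' : model P) (B : M -> M' -> Prop) :
    Prop :=
  forall (x : M) (x' : M'), B x x' ->
  [/\ forall p, kval p x <-> kval p x',
      forall y, kle x y -> exists2 y', kle x' y' & B y y',
      forall y', kle x' y' -> exists2 y, kle x y & B y y',
      forall y, kle y x -> exists2 y', kle y' x' & B y y' &
      forall y', kle y' x' -> exists2 y, kle y x & B y y'].

Definition bisimilar (P : Type) (M M' : model P) (x : M) (x' : M') : Prop :=
  exists2 B : M -> M' -> Prop, bisimulation B & B x x'.

(* Main.v *)
From mathcomp Require Import all_boot.
From mathcomp Require Import boolp classical_sets filter topology.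
Require Import Defs.

(** Logical equivalence is itself a bisimulation. If [x] and [x'] are logically
    equivalent and [x <= y], then [phi -> psi] fails at [x], hence at [x'],
    whenever [y] satisfies [phi] and not [psi]; so some point above [x']
    satisfies [phi] and not [psi]. As truth sets are clopen, compactness of the
    points above [x'] gives one that agrees with [y] on all formulae. Exclusion
    plays the same role for the points below. *)

Set Implicit Arguments.
Unset Strict Implicit.
Unset Printing Implicit Defensive.

Local Open Scope classical_set_scope.

Definition logically_equivalent (P : Type) (M N : model P) (x : M) (y : N) :
    Prop :=
  forall phi : formula P, truth phi x <-> truth phi y.

Lemma logically_equivalent_sym (P : Type) (M N : model P) (x : M) (y : N) :
  logically_equivalent x y -> logically_equivalent y x.
Proof. by move=> xy phi; split=> /xy. Qed.

Lemma bisimulation_truth (P : Type) (M M' : model P) (B : M -> M' -> Prop) :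
  bisimulation B -> forall x x', B x x' -> logically_equivalent x x'.
Proof.
move=> bisB x x' + phi.
elim: phi x x' => [||p|a IHa b IHb|a IHa b IHb|a IHa b IHb|a IHa b IHb] x x'
  xx' //=.
- by have [/(_ p)] := bisB _ _ xx'.
- by rewrite (propext (IHa _ _ xx')) (propext (IHb _ _ xx')).
- by rewrite (propext (IHa _ _ xx')) (propext (IHb _ _ xx')).
(* To carry the implication over to [x'], points above [x'] are pulled back by [back]; [forth]
   serves the converse. For exclusion, being existential, the two roles swap. *)
- have [_ forth back _ _] := bisB _ _ xx'; split.
  + move=> ab y' /back[y xy yy'] /(IHa _ _ yy') ya.
    by apply/(IHb _ _ yy'); exact: ab ya.
  + move=> ab y /forth[y' xy yy'] /(IHa _ _ yy') ya.
    by apply/(IHb _ _ yy'); exact: ab ya.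
- have [_ _ _ forth back] := bisB _ _ xx'; split.
  + move=> [y [/forth[y' xy yy'] ya yb]]; exists y'.
    by split; [|apply/(IHa _ _ yy')|move/(IHb _ _ yy')].
  + move=> [y' [/back[y xy yy'] ya yb]]; exists y.
    by split; [|apply/(IHa _ _ yy')|move/(IHb _ _ yy')].
Qed.

(** Each truth clause is an operation under which [A] is closed. Hence truth sets are clopen in
    [tau A], whichever witness [A] is given. *)
Lemma biint_collection_truth (P : Type) (M : model P) (A : set (set M)) :
  biint_collection A -> forall phi : formula P, A (@truth P M phi).
Proof.
move=> [_ [A0 AT AV] AU AI AIE].
elim=> [||p|a Aa b Ab|a Aa b Ab|a Aa b Ab|a Aa b Ab].
- exact: AT.
- exact: A0.
- exact: AV.
- exact: AI Aa Ab.
- exact: AU Aa Ab.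
- exact: (AIE _ _ Aa Ab).1.
- exact: (AIE _ _ Aa Ab).2.
Qed.

Lemma subbase_open (X : Type) (A : set (set X)) (a : set X) :
  subbase A a -> open (a : set (tau A)).
Proof.
move=> Aa; exists [set a]; last by rewrite bigcup_set1.
by move=> _ ->; exact: finI_from1.
Qed.

Lemma compact_logically_equivalent (P : Type) (M N : model P)
    (A : set (set N)) (K : set N) (y : M) :
  biint_collection A -> compact (K : set (tau A)) ->
  (forall phi psi : formula P, truth phi y -> ~ truth psi y ->
     exists2 z, K z & truth phi z /\ ~ truth psi z) ->
  exists2 z, K z & logically_equivalent y z.
Proof.
move=> /biint_collection_truth AT cK sat.
(* [F] is the filter generated by the traces on [K] of the sets [truth phi] minus [truth psi]. Pairs
   are used since the language has no Boolean negation. *)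
pose F : set (set (tau A)) := [set S | exists phi psi : formula P,
  [/\ truth phi y, ~ truth psi y &
      forall z : N, K z -> truth phi z -> ~ truth psi z -> S z]].
have FF : ProperFilter F.
  apply: Build_ProperFilter_ex => [S [phi [psi [yp yq S_]]]|].
    by have [z Kz [zp zq]] := sat _ _ yp yq; exists z; exact: S_.
  split.
  - by exists (Top P), (Bot P); split.
  - move=> S T [p [q [yp yq S_]]] [p' [q' [yp' yq' T_]]].
    (* Satisfying both [p] and [p'] while refuting both [q] and [q'] is again described by a single
       pair. *)
    exists (And p p'), (Or q q'); split=> /=; [by []|by case|].
    move=> z Kz [zp zp'] /not_orP[zq zq'].
    by split; [exact: S_|exact: T_].
  - move=> S T ST [p [q [yp yq S_]]]; exists p, q; split=> // z Kz zp zq.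
    exact/ST/S_.
have [|z [Kz clz]] := cK F FF.
  by exists (Top P), (Bot P); split.
(* If the cluster point [z] disagreed with [y] on [phi], then [truth phi] and its complement would
   be, in some order, a member of [F] and a neighbourhood of [z], yet they are disjoint. *)
exists z => // phi; split=> [yp|zp]; apply: contrapT => np.
- have [||w [wp]] := clz (truth phi) (~` truth phi); last by [].
  + by exists phi, (Bot P); split.
  + apply: open_nbhs_nbhs; split; last exact: np.
    by apply: subbase_open; right; exists (truth phi).
- have [||w [wp]] := clz (~` truth phi) (truth phi); last by [].
  + by exists (Top P), phi; split.
  + apply: open_nbhs_nbhs; split; last exact: zp.
    by apply: subbase_open; left.
Qed.

Lemma logically_equivalent_forth (P : Type) (M N : model P) :
  image_compact N -> forall (x : M) (x' : N), logically_equivalent x x' ->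
  forall y, kle x y -> exists2 y', kle x' y' & logically_equivalent y y'.
Proof.
move=> [A [bA cA]] x x' xx' y xy.
apply: (compact_logically_equivalent bA (cA x')) => phi psi yp yq.
apply: contrapT => no.
suff /xx' /(_ _ xy yp) : truth (Imp phi psi) x' by [].
by move=> z xz zp; apply: contrapT => zq; apply: no; exists z.
Qed.

Lemma logically_equivalent_forth_pred (P : Type) (M N : model P) :
  preimage_compact N -> forall (x : M) (x' : N), logically_equivalent x x' ->
  forall y, kle y x -> exists2 y', kle y' x' & logically_equivalent y y'.
Proof.
move=> [A [bA cA]] x x' xx' y yx.
apply: (compact_logically_equivalent bA (cA x')) => phi psi yp yq.
have /xx'[z [zx zp zq]] : truth (Excl phi psi) x by exists y.
by exists z.
Qed.

Theorem theorem4p10 (P : Type) (M M' : model P)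
    (ic : image_compact M) (pic : preimage_compact M)
    (ic' : image_compact M') (pic' : preimage_compact M')
    (x : M) (x' : M') :
  bisimilar x x' <-> (forall phi : formula P, truth phi x <-> truth phi x').
Proof.
split=> [[B bisB]|eqxx']; first exact: bisimulation_truth.
exists (@logically_equivalent P M M') => // {x x' eqxx'} x x' xx'.
have x'x := logically_equivalent_sym xx'.
split=> [p|y|y'|y|y'].
- exact: (xx' (Var p)).
- exact: logically_equivalent_forth.
(* The back condition is the forth condition with the two models exchanged, so compactness is now
   used in [M]. *)
- case/(logically_equivalent_forth ic x'x) => y xy /logically_equivalent_sym.
  by exists y.
- exact: logically_equivalent_forth_pred.
- case/(logically_equivalent_forth_pred pic x'x) => y yx.
  by move=> /logically_equivalent_sym; exists y.
Qed.
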